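(* For every turn sequence $\sigma$, the reachable set $A(\sigma)$ and the unreachable set $\mathbb{Z}^2\setminus A(\sigma)$ are both connected.
   Context: A turn sequence is a finite (possibly empty) word $\sigma=\sigma_1\cdots\sigma_n$ with $\sigma_i\in\{\texttt{L},\texttt{R}\}$ (left turn, right turn). A rectilinear chain realizes $\sigma$ if it is simple (no self-intersection), consists of $n+1$ axis-parallel segments of positive integer length, starts at the origin $o=(0,0)$ with its first segment heading east (direction $+x$), and at its $n$ successive bends makes the $90^\circ$ turns $\sigma_1,\dots,\sigma_n$ in order. Its endpoint $p\in\mathbb{Z}^2$ is said to be reachable by $\sigma$; $A(\sigma)\subseteq\mathbb{Z}^2$ is the set of all points reachable by $\sigma$. A subset of $\mathbb{Z}^2$ is connected if it induces a connected subgraph of the grid graph on $\mathbb{Z}^2$, in which two points are adjacent when they are at Euclidean distance $1$. *)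

(* Defs.v *)
From mathcomp Require Import all_boot all_order all_algebra.
From mathcomp Require Import classical_sets reals.

Set Implicit Arguments.
Unset Strict Implicit.
Unset Printing Implicit Defensive.

Import Order.TTheory GRing.Theory Num.Theory.
Local Open Scope ring_scope.
Local Open Scope classical_set_scope.

Inductive turn := TurnL | TurnR.

Notation point := (int * int)%type.

Definition rotate (d : point) (t : turn) : point :=
  match t with
  | TurnL => (- d.2, d.1)
  | TurnR => (d.2, - d.1)
  end.

Definition east : point := (1, 0).

Definition headings (s : seq turn) : seq point := east :: scanl rotate east s.

(* The origin, the bends and the endpoint, given the segment lengths [l]; this
   is meaningful only when [size l = (size s).+1], as [zip] truncates. *)
Definition vertices (s : seq turn) (l : seq nat) : seq point :=
  0 :: scanl +%R 0 [seq dk.1 *+ dk.2 | dk <- zip (headings s) l].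

Definition embed (R : realType) (p : point) : R * R := (p.1%:~R, p.2%:~R).

Definition segment (R : realType) (p q : point) : set (R * R) :=
  [set z | exists2 t : R, 0 <= t <= 1 &
     z = ((1 - t) * (embed R p).1 + t * (embed R q).1,
          (1 - t) * (embed R p).2 + t * (embed R q).2)].

(* [v] lists the vertices of a chain with nondegenerate segments, so that each
   segment is itself simple. *)
Definition simple_chain (R : realType) (v : seq point) : Prop :=
  forall i j : nat, (i < j)%N -> (j.+1 < size v)%N ->
  forall z : R * R,
    segment v`_i v`_i.+1 z -> segment v`_j v`_j.+1 z ->
    j = i.+1 /\ z = embed R v`_j.

Definition realizes (R : realType) (s : seq turn) (l : seq nat) : Prop :=
  [/\ size l = (size s).+1, all (fun k => 0 < k)%N l
    & simple_chain R (vertices s l)].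

Definition reachable (R : realType) (s : seq turn) : set point :=
  [set p | exists2 l : seq nat, realizes R s l & last 0 (vertices s l) = p].

(* Euclidean distance 1, squared to remain in the integers. *)
Definition adjacent : rel point :=
  [rel p q | (p.1 - q.1) ^+ 2 + (p.2 - q.2) ^+ 2 == 1].

(* Connectedness of the subgraph of the grid graph induced by [S], with
   the convention that the empty set is connected. *)
Definition grid_connected (S : set point) : Prop :=
  forall p q : point, S p -> S q ->
  exists w : seq point,
    [/\ path adjacent p w, last p w = q & forall x, x \in w -> S x].

(* Main.v *)
(* Disjoint axis-parallel segments are strictly separated in one coordinate, so
   a chain stays simple under every change of the coordinates of its vertices
   that preserves strict inequalities and the alignment of each segment. Thus:
   - an endpoint can be moved away from 0 in a coordinate where it is nonzero;
   - if (x, y) is reachable and the k-th segment is horizontal, doubling all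
     abscissas and translating the vertices after that segment by e in {-1, 0, 1}
     shows that (2x + e, y) is reachable; likewise for vertical segments.
   Complement: by the first fact an unreachable (x, y) can be moved towards
   x = +-1, then to x = 0 since (0, y) reachable would make (+-1, y) reachable,
   and then along the y-axis to the origin, which is unreachable.
   Reachable set: induction on the number of segments. If the new segment has
   heading (e, 0), then f(x, y) = (2x + e, y) maps the old set S to the new set T.
   It maps vertical neighbours to neighbours, and horizontal neighbours to points
   whose midpoints are in T. A point of T whose last segment starts at q is linked
   in T to f(q), first along that segment to q + (e, 0), then by the two facts. *)
Require Import Defs.
From mathcomp Require Import all_boot all_order all_algebra.
From mathcomp Require Import classical_sets reals.
From mathcomp Require Import zify ring lra.
Local Open Scope classical_set_scope.

Set Implicit Arguments.
Unset Strict Implicit.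
Unset Printing Implicit Defensive.

Import Order.TTheory GRing.Theory Num.Theory.
Local Open Scope ring_scope.

(** * Paths in the grid graph *)

(** The starting point is required to lie in S as well, so that paths can be reversed. *)
Definition linked (S : set Defs.point) (p q : Defs.point) :=
  exists w : seq Defs.point,
    [/\ path adjacent p w, last p w = q & forall x, x \in p :: w -> S x].

Lemma grid_connectedP (S : set Defs.point) :
  (forall p q, S p -> S q -> linked S p q) -> grid_connected S.
Proof.
move=> H p q Sp Sq; have [w [? ? ws]] := H p q Sp Sq.
by exists w; split=> // x xw; apply: ws; rewrite inE xw orbT.
Qed.

Lemma linked_of_connected (S : set Defs.point) p q :
  grid_connected S -> S p -> S q -> linked S p q.
Proof.
move=> H Sp Sq; have [w [? ? ws]] := H p q Sp Sq.
by exists w; split=> // x; rewrite inE => /orP[/eqP->|/ws].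
Qed.

Lemma linked_refl (S : set Defs.point) p : S p -> linked S p p.
Proof. by move=> Sp; exists [::]; split=> // x; rewrite inE => /eqP->. Qed.

Lemma linked_trans (S : set Defs.point) q p r :
  linked S p q -> linked S q r -> linked S p r.
Proof.
case=> w [pw wq Sw] [u [pu ur Su]]; exists (w ++ u).
split; first by rewrite cat_path pw wq pu.
  by rewrite last_cat wq.
move=> x; rewrite -cat_cons mem_cat => /orP[/Sw//|xu].
by apply: Su; rewrite inE xu orbT.
Qed.

Lemma adjacent_sym : symmetric adjacent.
Proof. by move=> p q; rewrite /adjacent /=; congr (_ == _); ring. Qed.

Lemma linked_sym (S : set Defs.point) p q : linked S p q -> linked S q p.
Proof.
case=> w [pw <- Sw]; exists (rev (belast p w)); split.
- by rewrite rev_path (eq_path (e' := adjacent)) // => a b; rewrite adjacent_sym.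
- by case: w {pw Sw} => [|a w] //=; rewrite rev_cons last_rcons.
- by move=> x; rewrite inE mem_rev -[_ || _]in_cons -mem_rcons -lastI => /Sw.
Qed.

Lemma linked_adjacent (S : set Defs.point) p q :
  S p -> S q -> adjacent p q -> linked S p q.
Proof.
move=> Sp Sq pq; exists [:: q]; split=> //=; first by rewrite pq.
by move=> x; rewrite !inE => /orP[]/eqP->.
Qed.

Definition between (a b t : int) := (a <= t <= b) || (b <= t <= a).

Lemma linked_row (S : set Defs.point) y a b :
  (forall t, between a b t -> S (t, y)) -> linked S (a, y) (b, y).
Proof.
have up (c : int) n : (forall t, c <= t <= c + n%:Z -> S (t, y)) ->
    linked S (c, y) (c + n%:Z, y).
  elim: n => [|n IH] H; first by rewrite addr0; apply/linked_refl/H; lia.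
  apply: linked_trans (IH _) _; first by move=> t ht; apply: H; lia.
  apply: linked_adjacent; [by apply: H; lia | by apply: H; lia|].
  by rewrite /adjacent /=; apply/eqP; rewrite !expr2; lia.
move=> H; have [ab|ba] := leP a b.
  have -> : b = a + `|b - a|%N%:Z by lia.
  by apply: up => t ht; apply: H; rewrite /between; lia.
apply: linked_sym; have -> : a = b + `|a - b|%N%:Z by lia.
by apply: up => t ht; apply: H; rewrite /between; lia.
Qed.

(** This reflection preserves adjacency and reduces vertical cases to horizontal ones. *)
Definition swap (p : Defs.point) : Defs.point := (p.2, p.1).

Lemma linked_swap (S : set Defs.point) p q :
  linked (swap @^-1` S) p q -> linked S (swap p) (swap q).
Proof.
case=> w [pw wq Sw]; exists (map swap w); split.
- rewrite (map_path (e' := adjacent) (b := xpred0)) //; last exact/hasPn.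
  by move=> a b _; rewrite /adjacent /= addrC.
- by rewrite last_map wq.
- by move=> x; rewrite -map_cons => /mapP[z /Sw ? ->].
Qed.

Lemma linked_col (S : set Defs.point) x a b :
  (forall t, between a b t -> S (x, t)) -> linked S (x, a) (x, b).
Proof. by move=> H; apply: (@linked_swap S (a, x) (b, x)); apply: linked_row. Qed.

Lemma grid_connected_swap (S : set Defs.point) :
  grid_connected (swap @^-1` S) -> grid_connected S.
Proof.
move=> H; apply: grid_connectedP => -[a b] [c d] Sp Sq.
by apply: (@linked_swap S (b, a) (d, c)); apply: linked_of_connected.
Qed.

(** * Connectedness criteria for expanding sets *)

Definition expanding (P : int -> Prop) :=
  (forall t, 0 < t -> P t -> P (t + 1)) /\ (forall t, t < 0 -> P t -> P (t - 1)).

Lemma expanding_between (P : int -> Prop) (a t : int) :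
  expanding P -> P a -> a != 0 -> (0 < a <= t) || (t <= a < 0) -> P t.
Proof.
move=> [up dn] Pa a0 h.
have H (n : nat) : (0 < a -> P (a + n%:Z)) /\ (a < 0 -> P (a - n%:Z)).
  elim: n => [|n [IHu IHd]]; first by split=> _; [rewrite addr0 | have -> : a - 0%:Z = a by lia].
  split=> h0.
    have -> : a + n.+1%:Z = a + n%:Z + 1 by lia.
    by apply: up; [lia | exact: IHu].
  have -> : a - n.+1%:Z = a - n%:Z - 1 by lia.
  by apply: dn; [lia | exact: IHd].
have [Hu Hd] := H `|t - a|%N.
have [h0|h0] := boolP (0 < a).
  by have -> : t = a + `|t - a|%N%:Z; [lia | apply: Hu].
by have -> : t = a - `|t - a|%N%:Z; [lia | apply: Hd; lia].
Qed.

Lemma complement_connected (T : set Defs.point) :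
  (forall y, expanding (fun x => T (x, y))) ->
  (forall x, expanding (fun y => T (x, y))) ->
  (forall y, T (0, y) -> T (1, y) /\ T (-1, y)) ->
  ~ T (0, 0) -> grid_connected (~` T).
Proof.
move=> Hx Hy Hs T0.
have col y : ~ T (0, y) -> linked (~` T) (0, y) (0, 0).
  move=> Ty; apply: linked_col => t ht Tt; apply: Ty.
  have [t0|t0] := eqVneq t 0; first by rewrite t0 in Tt.
  by apply: (expanding_between (Hy 0) Tt t0); rewrite /between in ht; lia.
have row x y : ~ T (x, y) -> linked (~` T) (x, y) (0, y).
  move=> Txy; apply: linked_row => t ht Tt; apply: Txy.
  have [t0|t0] := eqVneq t 0; last first.
    by apply: (expanding_between (Hx y) Tt t0); rewrite /between in ht; lia.
  (* Expansion says nothing at abscissa 0; it restarts from 1 or -1, whichever is on the side of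
     x. *)
  rewrite t0 in Tt; have [T1 T_1] := Hs _ Tt.
  have [x0|x0] := eqVneq x 0; first by rewrite x0.
  have [xp|xn] := boolP (0 < x).
    by apply: (expanding_between (Hx y) T1) => //; lia.
  by apply: (expanding_between (Hx y) T_1) => //; lia.
have all p : ~ T p -> linked (~` T) p (0, 0).
  case: p => x y Tp; apply: linked_trans (row _ _ Tp) _; apply: col => T0y.
  have [w [_ e Sw]] := row _ _ Tp.
  by apply: (Sw (0, y)) => //; rewrite -e; exact: mem_last.
apply: grid_connectedP => p q Tp Tq.
by apply: linked_trans (all _ Tp) (linked_sym (all _ Tq)).
Qed.

(** Here S and T stand for the endpoints before and after a horizontal segment of heading e is
    appended; the b of the third hypothesis is the abscissa where that segment starts. *)
Lemma extension_connected (S T : set Defs.point) (e : int) :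
  (e == 1) || (e == -1) -> grid_connected S ->
  (forall a y, T (a, y) -> exists b, [/\ S (b, y), 0 < (a - b) * e
     & forall t, between a (b + e) t -> T (t, y)]) ->
  (forall y, expanding (fun x => T (x, y))) ->
  (forall y, T (0, y) -> T (1, y) /\ T (-1, y)) ->
  (forall x y, S (x, y) -> T (2 * x + e, y)) ->
  (forall x y, S (x, y) -> S (x + e, y) -> T (2 * (x + e), y)) ->
  grid_connected T.
Proof.
move=> he cS Hlast Hx Hs Hf Hm.
pose f (p : Defs.point) : Defs.point := (2 * p.1 + e, p.2).
have fT p : S p -> T (f p) by case: p => x y; apply: Hf.
have fe p : S p -> S (p.1 + e, p.2) -> linked T (f p) (f (p.1 + e, p.2)).
  case: p => x y /= Sp Sq; rewrite /f /=; apply: linked_row => t ht.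
  (* The images are at distance 2, with midpoint of abscissa [2 * (x + e)]. *)
  have : (t == 2 * x + e) || (t == 2 * (x + e)) || (t == 2 * (x + e) + e).
    by rewrite /between in ht; lia.
  by move=> /orP[/orP[]|] /eqP->; [exact: Hf | exact: Hm | exact: Hf].
have fadj p q : S p -> S q -> adjacent p q -> linked T (f p) (f q).
  case: p q => a b [c d] Sp Sq; rewrite /adjacent /= => /eqP h.
  have := sqr_ge0 (a - c); have := sqr_ge0 (b - d) => h1 h2.
  have [bd|bd] := eqVneq b d.
    subst d; have : (c == a + e) || (a == c + e).
      by move: h; rewrite subrr expr0n addr0 => /eqP; rewrite sqrf_eq1; lia.
    case/orP=> /eqP ec; subst.
      exact: (fe (a, b)).
    by apply: linked_sym; apply: (fe (c, b)).
  have bd2 : (b - d) ^+ 2 != 0 by rewrite sqrf_eq0 subr_eq0.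
  have : (a - c) ^+ 2 == 0.
    by move: h h1 h2 bd2; move: (_ ^+ 2) (_ ^+ 2) => u v; lia.
  rewrite sqrf_eq0 subr_eq0 => /eqP ac; subst c.
  apply: linked_adjacent; [exact: fT | exact: fT |].
  by rewrite /adjacent /= subrr -h subrr.
have flink p q : S p -> S q -> linked T (f p) (f q).
  move=> Sp Sq; have [w [pw <- Sw]] := cS p q Sp Sq.
  elim: w p Sp pw Sw {q Sq} => [|r w IH] p Sp /=.
    by move=> _ _; apply/linked_refl/fT.
  move=> /andP[pr rw] Sw; have Sr : S r by apply: Sw; rewrite mem_head.
  apply: linked_trans (fadj _ _ Sp Sr pr) (IH _ Sr rw _) => x xw.
  by apply: Sw; rewrite inE xw orbT.
have toS p : T p -> exists2 q, S q & linked T p (f q).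
  case: p => a y Tp; have [b [Sb ab bt]] := Hlast _ _ Tp.
  exists (b, y) => //; apply: (@linked_trans _ (b + e, y)); first exact: linked_row.
  have Tbe : T (b + e, y) by apply: bt; rewrite /between; lia.
  rewrite /f /=; apply: linked_row => t ht.
  (* From [b + e] to [2 * b + e] the shift is b, which never points towards 0 if [b + e != 0];
     otherwise the target is -e, a neighbour of 0. *)
  have [be|be] := eqVneq (b + e) 0; last first.
    by apply: (expanding_between (Hx y) Tbe be); rewrite /between in ht; lia.
  rewrite be in Tbe; have [T1 T_1] := Hs _ Tbe.
  have : (t == 0) || (t == 1) || (t == -1) by rewrite /between in ht; lia.
  by move=> /orP[/orP[]|] /eqP->.
apply: grid_connectedP => p q /toS[p' Sp' pp'] /toS[q' Sq' qq'].
by apply: linked_trans pp' (linked_trans (flink _ _ Sp' Sq') (linked_sym qq')).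
Qed.

(** * Chains in integral terms *)

Definition dir (d a b : int) : bool :=
  [|| (d == 0) && (a == b), (d == 1) && (a < b) | (d == -1) && (b < a)].

Definition before (x : nat -> int) (i j : nat) : bool :=
  [&& x i < x j, x i < x j.+1, x i.+1 < x j & x i.+1 < x j.+1].

(* For axis-parallel segments, being separated by a strict inequality in one
   coordinate is the same as being disjoint. *)
Definition apart (x y : nat -> int) (i j : nat) : bool :=
  [|| before x i j, before x j i, before y i j | before y j i].

(* Integral description of the chains with [m] segments: [x] and [y] give the
   coordinates of the vertices, [hx] and [hy] those of the headings. *)
Definition chain (hx hy : nat -> int) (m : nat) (x y : nat -> int) : Prop :=
  [/\ x 0%N = 0, y 0%N = 0,
      forall k, (k < m)%N -> dir (hx k) (x k) (x k.+1) && dir (hy k) (y k) (y k.+1)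
    & forall i j, (i.+1 < j < m)%N -> apart x y i j].

Definition chain_ends (hx hy : nat -> int) (m : nat) : set Defs.point :=
  [set p | exists x y, chain hx hy m x y /\ (x m, y m) = p].

Definition axial (a b : int) : bool :=
  [|| (a == 0) && (b == 1), (a == 0) && (b == -1),
      (a == 1) && (b == 0) | (a == -1) && (b == 0)].

(** All that the argument on chains retains of a turn sequence. *)
Definition alternating (hx hy : nat -> int) (m : nat) : Prop :=
  (forall k, (k < m)%N -> axial (hx k) (hy k)) /\
  (forall k, (k.+1 < m)%N -> (hx k == 0) = (hx k.+1 != 0)).

Lemma chain_swap hx hy m x y : chain hx hy m x y -> chain hy hx m y x.
Proof.
case=> x0 y0 st ap; split=> // [k km|i j ij]; first by rewrite andbC; exact: st.
by have := ap i j ij; rewrite /apart; lia.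
Qed.

Lemma chain_ends_swap hx hy m :
  swap @^-1` chain_ends hx hy m = chain_ends hy hx m.
Proof.
apply/seteqP; split=> -[a b] /= [x [y [c [<- <-]]]];
  by exists y, x; split=> //; exact: chain_swap.
Qed.

(** * Perturbing the coordinates of a chain *)

Lemma apart_mono (x y x' y' : nat -> int) i j :
  (forall a b, x a < x b -> x' a < x' b) ->
  (forall a b, y a < y b -> y' a < y' b) -> apart x y i j -> apart x' y' i j.
Proof.
by move=> hx hy /or4P[] /and4P[? ? ? ?]; apply/or4P;
  [constructor 1 | constructor 2 | constructor 3 | constructor 4];
  apply/and4P; split; auto.
Qed.

Lemma chain_ends_expanding hx hy m y :
  expanding (fun x => chain_ends hx hy m (x, y)).
Proof.
have H (e t : int) : (e == 1) && (0 < t) || (e == -1) && (t < 0) ->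
    chain_ends hx hy m (t, y) -> chain_ends hx hy m (t + e, y).
  move=> het [u [v [[u0 v0 st ap] [ut vy]]]].
  (* All vertices at abscissa t or beyond it are pushed outwards by e; the origin, strictly on the
     other side, stays fixed. *)
  pose u' i := u i + (if 0 <= (u i - t) * e then e else 0).
  exists u', v; split; last by rewrite /u' ut subrr mul0r lexx vy.
  have mono a b : u a < u b -> u' a < u' b.
    by rewrite /u'; case: ifP; case: ifP; nia.
  split=> // [|k km|i j ij].
  - by rewrite /u' u0; case: ifP => //; nia.
  - have := st k km; rewrite /dir => /andP[h ->]; rewrite andbT.
    have := mono k k.+1; have := mono k.+1 k.
    have : u k = u k.+1 -> u' k = u' k.+1 by rewrite /u' => ->.
    by lia.
  - by apply: apart_mono (ap i j ij).
by split=> t t0; apply: H; lia.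
Qed.

(** Doubling turns strict inequalities into gaps of at least 2, which survive a relative shift of at
    most 1. Only segment k has its two ends shifted differently, and it is horizontal. *)
Lemma chain_ends_slide hx hy m k x y (e : int) :
  (k < m)%N -> hx k != 0 -> -1 <= e <= 1 ->
  chain_ends hx hy m (x, y) -> chain_ends hx hy m (2 * x + e, y).
Proof.
move=> km hk he [u [v [[u0 v0 st ap] [ut vy]]]].
pose u' i := 2 * u i + (if (k < i)%N then e else 0).
exists u', v; split; last by rewrite /u' km ut vy.
split=> // [|l lm|i j ij].
- by rewrite /u' u0.
- have := st l lm; rewrite /dir => /andP[h ->]; rewrite andbT.
  have [lk|lk] := eqVneq l k; first by subst l; rewrite /u' ltnn ltnSn; lia.
  have -> : u' l = 2 * u l + (if (k < l.+1)%N then e else 0).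
    by rewrite /u'; have -> : (k < l.+1)%N = (k < l)%N by lia.
  by rewrite /u'; case: ifP; lia.
- by apply: apart_mono (ap i j ij) => // a b; rewrite /u'; do 2 case: ifP; lia.
Qed.

Lemma chain_ends_slide0 hx hy m k y : (k < m)%N -> hx k != 0 ->
  chain_ends hx hy m (0, y) ->
  chain_ends hx hy m (1, y) /\ chain_ends hx hy m (-1, y).
Proof.
move=> km hk T0.
by split; [apply: (chain_ends_slide (e := 1) km hk _ T0) |
           apply: (chain_ends_slide (e := -1) km hk _ T0)].
Qed.

(** With at least three segments, the first and the last would share the origin without being
    consecutive; with one or two, some coordinate of the endpoint is nonzero. *)
Lemma origin_not_chain_end hx hy m : (0 < m)%N -> alternating hx hy m ->
  ~ chain_ends hx hy m (0, 0).
Proof.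
move=> m0 [ax alt] [x [y [[x0 y0 st ap] [xm ym]]]].
case: m m0 ax alt st ap xm ym => [//|[|[|m]]] _ ax alt st ap xm ym.
- by have := ax 0%N isT; have := st 0%N isT; rewrite /dir /axial; lia.
- have := ax 0%N isT; have := st 0%N isT; have := alt 0%N isT.
  by have := ax 1%N isT; have := st 1%N isT; rewrite /dir /axial; lia.
- by have := ap 0%N m.+2 (ltnSn _); rewrite /apart /before x0 y0 xm ym; lia.
Qed.

(** The last segment can be shortened down to length 1, since a part of it remains apart from the
    others. *)
Lemma chain_ends_last hx hy m a y (e := hx m) : axial (hx m) (hy m) -> e != 0 ->
  chain_ends hx hy m.+1 (a, y) ->
  exists b, [/\ chain_ends hx hy m (b, y), 0 < (a - b) * e
     & forall t, between a (b + e) t -> chain_ends hx hy m.+1 (t, y)].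
Proof.
move=> ax e0 [u [v [[u0 v0 st ap] [ua vy]]]].
have := st m (ltnSn m) => /andP[sx sy].
have vm : v m = y by move: sy; rewrite -vy /dir /axial in ax *; lia.
exists (u m); split.
- exists u, v; split; last by rewrite vm.
  by split=> // [k km|i j ij]; [apply: st | apply: ap]; lia.
- by move: sx; rewrite ua /dir -/e; nia.
- move=> t ht; pose u' i := if i == m.+1 then t else u i.
  exists u', v; split; last by rewrite /u' eqxx vy.
  have ltu i : (i < m.+1)%N -> u' i = u i by rewrite /u' => im; case: eqP => //; lia.
  have um : u' m.+1 = t by rewrite /u' eqxx.
  split=> // [k km|i j ij].
    have := st k km => /andP[skx ->]; rewrite andbT ltu //.
    have [-> |kn] := eqVneq k m; last by rewrite ltu //; lia.
    by move: sx ht; rewrite um ua /between /dir -/e /axial -/e in ax *; lia.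
  have := ap i j ij; rewrite /apart /before !(ltu i) ?(ltu i.+1) ?(ltu j); try lia.
  have [jm|jm] := eqVneq j m; last by rewrite ltu //; lia.
  subst j; rewrite um ua.
  by move: sx ht; rewrite ua /between /dir -/e /axial -/e in ax *; lia.
Qed.

(* The end of the chain is repeated, as a degenerate last segment, before the
   coordinates are perturbed. *)
Lemma chain_extend hx hy m u v (d : nat -> int) (e := hx m) :
  alternating hx hy m.+1 -> e != 0 -> chain hx hy m u v ->
  (forall i j, d i - d j <= 1) -> d 0%N = 0 ->
  (forall k, (k < m)%N -> hx k == 0 -> d k = d k.+1) -> d m.+1 - d m = e ->
  chain_ends hx hy m.+1 (2 * u m + d m.+1, v m).
Proof.
move=> [ax alt] e0 [u0 v0 st ap] d1 d0 dk dm.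
pose w (f : nat -> int) i := f (minn i m).
have wl f i : (i <= m)%N -> w f i = f i by rewrite /w => /minn_idPl->.
have wm f : w f m.+1 = f m by rewrite /w (minn_idPr _).
clearbody w.
pose u' i := 2 * w u i + d i.
have u'E i : u' i = 2 * w u i + d i by [].
clearbody u'.
exists u', (w v); split; last by rewrite !u'E !wm.
split=> [| |k km|i j ij].
- by rewrite !u'E wl // u0 d0.
- by rewrite wl.
- have [kn|kn] := eqVneq k m.
    subst k; have := ax m km; rewrite !u'E !wm !wl // /dir /axial -/e.
    by move: dm; rewrite -/e; move: e0; lia.
  have km' : (k < m)%N by lia.
  have := st k km'; rewrite !u'E !(wl _ k) 1?ltnW // !(wl _ k.+1) //.
  move=> /andP[h ->]; rewrite andbT.
  move: h (dk k km') (d1 k k.+1) (d1 k.+1 k); rewrite /dir.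
  by case: eqP => /= h0; lia.
- apply: (@apart_mono (w u) (w v)) => // [a b|]; first by have := d1 a b; rewrite !u'E; lia.
  have [jm|jm] := eqVneq j m; last first.
    by rewrite /apart /before !wl; first (by apply: ap; lia); lia.
  subst j; rewrite /apart /before !wm !(wl _ i) ?(wl _ i.+1) ?(wl _ m) //; try lia.
  (* The degenerate segment is the old endpoint. If [i.+2 < m], segment i is apart from the last old
     segment, hence from its end. *)
  have [im|im] := eqVneq i.+2 m; last first.
    case: m st ap ij im {ax alt e0 e dk dm u' u'E w wl wm} => [|m] st ap ij im; first by lia.
    have im' : (i.+1 < m < m.+1)%N by lia.
    have := ap i m im'.
    by case/or4P=> /and4P[_ h1 h2 h3]; rewrite ?h1 ?h2 ?h3 /= ?orbT.
  subst m.
  (* The new heading is horizontal, so segment [i.+1] is vertical and segment i horizontal: the end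
     of the former has another ordinate than the latter. *)
  have vi : v i = v i.+1.
    have := st i; have := alt i; have := alt i.+1; have := ax i; have := ax i.+1.
    by rewrite /axial /dir -/e; lia.
  have /orP[h|h] : (v i.+1 < v i.+2) || (v i.+2 < v i.+1).
    by have := st i.+1; have := alt i.+1; have := ax i.+1; rewrite /axial /dir -/e; lia.
  - by rewrite vi h /= !orbT.
  - by rewrite vi h /= !orbT.
Qed.

Lemma chain_ends_extend hx hy m x y (e := hx m) :
  alternating hx hy m.+1 -> e != 0 -> chain_ends hx hy m (x, y) ->
  chain_ends hx hy m.+1 (2 * x + e, y).
Proof.
move=> al e0 [u [v [c [<- <-]]]].
have ax : axial (hx m) (hy m) by apply: al.1.
have := @chain_extend hx hy m u v (fun i => if i == m.+1 then e else 0) al e0 c.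
rewrite eqxx; apply=> //.
- by move=> i j; do 2 case: ifP; rewrite /axial -/e in ax *; lia.
- by move=> k km _; do 2 case: ifP; lia.
- by rewrite ifF; lia.
Qed.

(** In the doubled chain ending at [2 * (x + e)], the last segment, which is vertical, is shifted by
    -e to make room for a new segment of length 1 back to that abscissa. *)
Lemma chain_ends_extend_mid hx hy m x y (e := hx m) :
  alternating hx hy m.+1 -> e != 0 ->
  chain_ends hx hy m (x, y) -> chain_ends hx hy m (x + e, y) ->
  chain_ends hx hy m.+1 (2 * (x + e), y).
Proof.
move=> al e0 [u1 [v1 [c1 [u1x v1y]]]] [u [v [c [ux vy]]]].
have ax : axial (hx m) (hy m) by apply: al.1.
(* The shifted vertex [m.-1] must not be the origin. For [m <= 1] all endpoints have abscissa 0, so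
   x and [x + e] cannot both occur. *)
have m2 : (1 < m)%N.
  have flat w z : chain hx hy m w z -> (m <= 1)%N -> w m = 0.
    case: m @e al e0 ax {c1 u1x v1y c ux vy} => [|[|//]] e al e0 ax [w0 _ st _] _ //.
    have := st 0%N isT; have := al.2 0%N isT; have := al.1 0%N isT.
    by rewrite /dir /axial -/e w0; lia.
  by rewrite ltnNge; apply/negP => m1; move: (flat _ _ c1 m1) (flat _ _ c m1); lia.
pose d i := if (i == m.-1) || (i == m) then - e else 0.
have dE : d m.+1 = 0 by rewrite /d ifF //; lia.
have := @chain_extend hx hy m u v d al e0 c; rewrite ux vy dE addr0; apply.
- by move=> i j; rewrite /d; do 2 case: ifP; rewrite /axial -/e in ax *; lia.
- by rewrite /d ifF //; lia.
- move=> k km hk; have [km1|km1] := eqVneq k.+2 m.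
    by have := al.2 k; have := al.2 k.+1; rewrite km1 -/e; lia.
  by rewrite /d; do 2 case: ifP; lia.
- by rewrite /d eqxx orbT sub0r opprK.
Qed.

(** * Connectedness for chains *)

Lemma chain_ends_connected hx hy m : alternating hx hy m ->
  grid_connected (chain_ends hx hy m).
Proof.
have horizontal gx gy n : alternating gx gy n.+1 -> gx n != 0 ->
    grid_connected (chain_ends gx gy n) -> grid_connected (chain_ends gx gy n.+1).
  move=> al g0 cn; have ax := al.1 n (ltnSn n).
  apply: (@extension_connected (chain_ends gx gy n) _ (gx n)) => //.
  - by rewrite /axial in ax; lia.
  - by move=> a y; apply: chain_ends_last.
  - by move=> y; apply: chain_ends_expanding.
  - by move=> y; apply: (@chain_ends_slide0 _ _ _ n).
  - by move=> x y; apply: chain_ends_extend.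
  - by move=> x y; apply: chain_ends_extend_mid.
elim: m => [|m IH] al.
  apply: grid_connectedP => p q [x [y [[x0 y0 _ _] <-]]] [x' [y' [[x'0 y'0 _ _] <-]]].
  rewrite x0 y0 x'0 y'0; apply: linked_refl.
  by exists x, y; split; [split=> // i j; lia | rewrite x0 y0].
have {}IH : grid_connected (chain_ends hx hy m).
  by apply: IH; split=> k km; [apply: al.1 | apply: al.2]; lia.
have [h0|h0] := eqVneq (hx m) 0; last exact: horizontal.
apply: grid_connected_swap; rewrite chain_ends_swap; apply: horizontal.
- split=> k km; have := al.1 k; first by rewrite /axial; lia.
  by have := al.1 k.+1; have := al.2 k; rewrite /axial; lia.
- by have := al.1 m; rewrite /axial; lia.
- by apply: grid_connected_swap; rewrite chain_ends_swap.
Qed.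

Lemma chain_ends_complement_connected hx hy m : (0 < m)%N -> hx 0%N != 0 ->
  alternating hx hy m -> grid_connected (~` chain_ends hx hy m).
Proof.
move=> m0 h0 al; apply: complement_connected.
- by move=> y; apply: chain_ends_expanding.
- move=> x; have [up dn] := @chain_ends_expanding hy hx m x.
  by rewrite -chain_ends_swap in up dn.
(* Slides at the first segment, which is horizontal, leave the y-axis on either side. *)
- by move=> y; apply: chain_ends_slide0 m0 h0.
- exact: origin_not_chain_end.
Qed.

(** * Real segments and integral separation *)

Lemma convex_bounds (R : realType) (a b c t : R) : 0 <= t <= 1 ->
  (a <= c -> b <= c -> (1 - t) * a + t * b <= c) /\
  (c <= a -> c <= b -> c <= (1 - t) * a + t * b).
Proof. by move=> /andP[t0 t1]; split=> ac bc; nra. Qed.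

Lemma convex_int (R : realType) (a b c : int) : between a b c ->
  exists2 t : R, 0 <= t <= 1 & c%:~R = (1 - t) * a%:~R + t * b%:~R.
Proof.
have pos u v w : u <= w <= v -> u < v ->
    exists2 t : R, 0 <= t <= 1 & w%:~R = (1 - t) * u%:~R + t * v%:~R.
  move=> /andP[uw wv] uv; have p : 0 < (v - u)%:~R :> R by rewrite ltr0z subr_gt0.
  exists ((w - u)%:~R / (v - u)%:~R); last first.
    by move: (lt0r_neq0 p); rewrite !intrB => nz; field.
  apply/andP; split; first by rewrite divr_ge0 ?(ltW p) // ler0z subr_ge0.
  by rewrite ler_pdivrMr // mul1r ler_int lerD2r.
have [ab|ba|<-] := ltgtP a b => /orP h.
- by apply: pos => //; lia.
- have [|//|t t01 ->] := @pos b a c; first by lia.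
  by exists (1 - t); [lra | ring].
- have -> : c = a by lia.
  by exists 0; [rewrite lexx ler01 | ring].
Qed.

Lemma segment_int (R : realType) (p q z : Defs.point) :
  between p.1 q.1 z.1 -> between p.2 q.2 z.2 ->
  (p.1 == q.1) || (p.2 == q.2) -> segment p q (embed R z).
Proof.
case: p q z => a b [c d] [u v] /= hu hv /orP[]/eqP e; subst.
  have [t t01 vt] := convex_int R hv; exists t => //=; rewrite /embed /= -vt.
  by have -> : u = c; [move: hu; rewrite /between; lia | congr (_, _); ring].
have [t t01 ut] := convex_int R hu; exists t => //=; rewrite /embed /= -ut.
by have -> : v = d; [move: hv; rewrite /between; lia | congr (_, _); ring].
Qed.

(** Two integral intervals that are not strictly separated share an end of one of them; this is
    applied to each coordinate. *)
Lemma apartPn x y i j : ~~ apart x y i j ->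
  exists a b, [/\ between (x i) (x i.+1) a, between (x j) (x j.+1) a,
                  between (y i) (y i.+1) b & between (y j) (y j.+1) b].
Proof.
have meet (f : nat -> int) : ~~ before f i j -> ~~ before f j i ->
    exists c, between (f i) (f i.+1) c && between (f j) (f j.+1) c.
  rewrite /before => h1 h2.
  pose P c := between (f i) (f i.+1) c && between (f j) (f j.+1) c.
  have : [|| P (f i), P (f i.+1), P (f j) | P (f j.+1)].
    by rewrite /P /between; lia.
  by case/or4P=> ?; eexists; eassumption.
rewrite /apart !negb_or => /and4P[x1 x2 y1 y2].
have [a /andP[? ?]] := meet _ x1 x2; have [b /andP[? ?]] := meet _ y1 y2.
by exists a, b.
Qed.

Lemma before_disjoint (R : realType) (x : nat -> int) i j (t u : R) :
  before x i j -> 0 <= t <= 1 -> 0 <= u <= 1 ->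
  (1 - t) * (x i)%:~R + t * (x i.+1)%:~R
    < (1 - u) * (x j)%:~R + u * (x j.+1)%:~R.
Proof.
move=> /and4P[h1 h2 h3 h4] ht hu.
have [c [h5 h6 h7 h8]] : exists c : int, [/\ x i <= c, x i.+1 <= c, c < x j & c < x j.+1].
  have [le|le] := leP (x i) (x i.+1); first by exists (x i.+1).
  by exists (x i); split=> //; exact: ltW.
apply: (@le_lt_trans _ _ c%:~R).
  by apply: (convex_bounds _ _ _ ht).1; rewrite ler_int.
apply: (@lt_le_trans _ _ (c + 1)%:~R); first by rewrite ltr_int; lia.
by apply: (convex_bounds _ _ _ hu).2; rewrite ler_int; lia.
Qed.

(** An axis-parallel segment fills its bounding box, so two segments that are not apart meet in an
    integral point. Consecutive segments are perpendicular and meet only at their common vertex. *)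
Lemma simple_chainP (R : realType) (v : seq Defs.point) hx hy m
    (x := fun k => (v`_k).1) (y := fun k => (v`_k).2) :
  size v = m.+1 -> alternating hx hy m ->
  (forall k, (k < m)%N -> dir (hx k) (x k) (x k.+1) && dir (hy k) (y k) (y k.+1)) ->
  simple_chain R v <-> forall i j, (i.+1 < j < m)%N -> apart x y i j.
Proof.
move=> sv [ax alt] st.
have flat k : (k < m)%N -> (x k == x k.+1) || (y k == y k.+1).
  by move=> km; have := st k km; have := ax k km; rewrite /axial /dir; lia.
split=> [sc i j ij | ap i j ij jm z].
  apply/contraT => /apartPn[a [b [ai aj bi bj]]].
  have si : segment v`_i v`_i.+1 (embed R (a, b)).
    by apply: segment_int => //; apply: flat; lia.
  have sj : segment v`_j v`_j.+1 (embed R (a, b)).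
    by apply: segment_int => //; apply: flat; lia.
  by have [] := sc i j _ _ _ si sj; rewrite ?sv; lia.
rewrite sv ltnS in jm.
move=> [t ht ->] [u hu []]; rewrite -!/(x _) -!/(y _) /= => e1 e2.
have [ji|ji] := eqVneq j i.+1; last first.
  have /ap : (i.+1 < j < m)%N by lia.
  case/or4P=> b.
  - by have := before_disjoint b ht hu; rewrite e1 ltxx.
  - by have := before_disjoint b hu ht; rewrite e1 ltxx.
  - by have := before_disjoint b ht hu; rewrite e2 ltxx.
  - by have := before_disjoint b hu ht; rewrite e2 ltxx.
subst j; split=> //.
have im : (i < m)%N by lia.
(* Each coordinate of the common point is fixed by the segment on which it is constant. *)
have : (x i == x i.+1) && (y i.+1 == y i.+2) || (y i == y i.+1) && (x i.+1 == x i.+2).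
  have := st i im; have := st i.+1 jm; have := ax i im; have := ax i.+1 jm.
  by have := alt i jm; rewrite /axial /dir; lia.
rewrite /embed -/(x _) -/(y _) => /orP[]/andP[/eqP e3 /eqP e4].
  by congr (_, _); [rewrite e3; ring | rewrite e2 -e4; ring].
by congr (_, _); [rewrite e1 -e4; ring | rewrite e3; ring].
Qed.

(** * Turn sequences as chains *)

Lemma nth_scanlS (A B : Type) (g : A -> B -> A) a b x (s : seq B) k :
  (k < size s)%N ->
  nth a (x :: scanl g x s) k.+1 = g (nth a (x :: scanl g x s) k) (nth b s k).
Proof.
elim: s x k => // c s IH x [|k] ks //=.
by have := IH (g x c) k ks; rewrite /=.
Qed.

Lemma headings_alternating (s : seq turn) :
  alternating (fun k => ((headings s)`_k).1) (fun k => ((headings s)`_k).2)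
    (size s).+1.
Proof.
have S k : (k < size s)%N ->
    (headings s)`_k.+1 = rotate (headings s)`_k (nth TurnL s k).
  exact: nth_scanlS.
have ax k : (k < (size s).+1)%N -> axial ((headings s)`_k).1 ((headings s)`_k).2.
  elim: k => // k IH ks; rewrite S //; move: (IH (ltnW ks)).
  by case: ((headings s)`_k) => a b; case: (nth _ _ _); rewrite /axial /=; lia.
split=> // k ks; rewrite S //; have := ax k (ltnW ks).
by case: ((headings s)`_k) => a b; case: (nth _ _ _); rewrite /axial /=; lia.
Qed.

Lemma mulrn_pair (p : Defs.point) n : p *+ n = (p.1 * n%:Z, p.2 * n%:Z).
Proof.
rewrite -!natz !mulr_natr.
by elim: n => [|n IH]; rewrite ?mulr0n // !mulrS IH; case: p {IH}.
Qed.

Lemma size_vertices s l : size l = (size s).+1 ->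
  size (vertices s l) = (size s).+2.
Proof.
move=> sl; rewrite /vertices /= size_scanl size_map size_zip sl.
by rewrite /headings /= size_scanl minnn.
Qed.

Lemma nth_verticesS s l k : size l = (size s).+1 -> (k < (size s).+1)%N ->
  (vertices s l)`_k.+1 = (vertices s l)`_k + (headings s)`_k *+ nth 0%N l k.
Proof.
move=> sl ks; have sh : size (headings s) = size l.
  by rewrite sl /headings /= size_scanl.
have sz : size (zip (headings s) l) = (size s).+1 by rewrite size_zip sh sl minnn.
rewrite /vertices (nth_scanlS _ _ 0) ?size_map ?sz //.
by rewrite (nth_map (0, 0%N)) ?sz // nth_zip.
Qed.

Lemma vertices_dir s l k : size l = (size s).+1 -> all (fun k => 0 < k)%N l ->
  (k < (size s).+1)%N ->
  dir ((headings s)`_k).1 ((vertices s l)`_k).1 ((vertices s l)`_k.+1).1 &&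
  dir ((headings s)`_k).2 ((vertices s l)`_k).2 ((vertices s l)`_k.+1).2.
Proof.
move=> sl lpos ks; rewrite nth_verticesS // mulrn_pair /=.
have : (0 < nth 0 l k)%N by apply: (all_nthP 0%N lpos); rewrite sl.
have := (headings_alternating s).1 k ks; rewrite /axial /dir.
by case: ((headings s)`_k) => a b /=; case/or4P=> /andP[/eqP-> /eqP->]; lia.
Qed.

Lemma reachable_chain_ends (R : realType) (s : seq turn) :
  reachable R s = chain_ends (fun k => ((headings s)`_k).1)
    (fun k => ((headings s)`_k).2) (size s).+1.
Proof.
have al := headings_alternating s.
have lastE l : size l = (size s).+1 ->
    last 0 (vertices s l) = (vertices s l)`_(size s).+1.
  by move=> sl; rewrite -nth_last size_vertices.
apply/seteqP; split=> p.
  case=> l [sl lpos sc] <-; have st k := @vertices_dir s l k sl lpos.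
  exists (fun k => ((vertices s l)`_k).1), (fun k => ((vertices s l)`_k).2).
  split; last by rewrite lastE // -surjective_pairing.
  split=> //; exact/(simple_chainP R (size_vertices sl) al st).
case=> x [y [[x0 y0 st ap] <-]].
(* One of the two summands vanishes, so their sum is the length of the segment. *)
pose l := mkseq (fun k => `|x k.+1 - x k|%N + `|y k.+1 - y k|%N)%N (size s).+1.
have sl : size l = (size s).+1 by rewrite size_mkseq.
have lpos : all (fun k => 0 < k)%N l.
  apply/(all_nthP 0%N) => k; rewrite sl => ks; rewrite nth_mkseq //.
  by have := st k ks; have := al.1 k ks; rewrite /dir /axial; lia.
have vE k : (k <= (size s).+1)%N -> (vertices s l)`_k = (x k, y k).
  elim: k => [|k IH] ks; first by rewrite x0 y0.
  rewrite nth_verticesS // IH 1?ltnW // nth_mkseq // mulrn_pair.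
  have := st k ks; have := al.1 k ks; rewrite /axial /dir.
  case: ((headings s)`_k) => a b /= h1 h2.
  by congr (_, _) => /=; move: h1 h2; case/or4P=> /andP[/eqP-> /eqP->]; lia.
exists l; last by rewrite lastE // vE.
have st' k := @vertices_dir s l k sl lpos.
split=> //; apply/(simple_chainP R (size_vertices sl) al st').
move=> i j ij; have := ap i j ij.
by rewrite /apart /before !vE //=; lia.
Qed.

Theorem theorem6 (R : realType) (s : seq turn) :
  grid_connected (reachable R s) /\ grid_connected (~` reachable R s).
Proof.
have al := headings_alternating s; rewrite reachable_chain_ends.
by split; [exact: chain_ends_connected | exact: chain_ends_complement_connected].
Qed.
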